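(* If a Lindelöf space $X$ is the union of fewer than $\mathrm{cov}(\mathcal{M})$ subspaces each of which satisfies $S_1^*(\mathcal{O},\Gamma)$, then $X$ is star-Rothberger.
   Context: Spaces are nonempty topological spaces. No separation axiom is included in ''Lindelöf''. $\mathrm{cov}(\mathcal{M})$ is the minimum cardinality of a family of meager subsets of $\mathbb{R}$ that covers $\mathbb{R}$; equivalently, the minimum cardinality of a set $F\subseteq\mathbb{N}^{\mathbb{N}}$ such that for every $g\in\mathbb{N}^{\mathbb{N}}$ there is an $f\in F$ with $f(n)\neq g(n)$ for all but finitely many $n$. For $A\subseteq Z$ and a collection $\mathcal{P}$ of subsets of $Z$, $St(A,\mathcal{P})=\bigcup\{B\in\mathcal{P} : A\cap B\neq\emptyset\}$. A space $Z$ satisfies $S_1^*(\mathcal{O},\Gamma)$ if for each sequence $(\mathcal{U}_n)_{n\in\mathbb{N}}$ of open covers of $Z$ there are $V_n\in\mathcal{U}_n$ such that each $z\in Z$ belongs to $St(V_n,\mathcal{U}_n)$ for all but finitely many $n$. A space $Z$ is star-Rothberger if for each sequence $(\mathcal{U}_n)_{n\in\mathbb{N}}$ of open covers of $Z$ there are $V_n\in\mathcal{U}_n$ such that $\{St(V_n,\mathcal{U}_n) : n\in\mathbb{N}\}$ covers $Z$. *)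

(* Defs.v *)
From HB Require Import structures.
From mathcomp Require Import all_boot all_order all_algebra.
From mathcomp Require Import all_classical all_reals topology normedtype.
Set Implicit Arguments.
Unset Strict Implicit.
Unset Printing Implicit Defensive.
Import Order.TTheory GRing.Theory Num.Theory numFieldNormedType.Exports.
Local Open Scope classical_set_scope.
Local Open Scope card_scope.

Definition card_lt (T U : Type) (A : set T) (B : set U) : bool :=
  (A #<= B) && ~~ (B #<= A).

(* The maximal elements among the sets of pairwise everywhere distinct choice
   functions on P cover some A in P, which then embeds in every member of P. *)
Lemma least_card (T : pointedType) (P : set (set T)) : P !=set0 ->
  exists A, P A /\ forall B, P B -> A #<= B.
Proof.
move=> [A0 PA0].
pose Q (M : set (set T -> T)) :=
  (forall g A, M g -> P A -> A (g A)) /\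
  (forall g h A, M g -> M h -> P A -> g A = h A -> g = h).
have [|M [[Msec Minj] Mmax]] := @Zorn_bigcup (set T -> T) Q.
  move=> F FQ Ftot; split=> [g A [M FM Mg] PA|g h A [M FM Mg] [N FN Nh] PA].
    exact: (FQ _ FM).1 g A Mg PA.
  have [MN|NM] := Ftot _ _ FM FN.
    by apply: ((FQ _ FN).2 g h A) => //; exact: MN.
  by apply: ((FQ _ FM).2 g h A) => //; exact: NM.
have [A [PA AM]] : exists A, P A /\ A `<=` (fun g => g A) @` M.
  apply: contrapT => noA.
  have /choice[g0 g0P] A : exists x, P A -> A x /\ ~ ((fun g => g A) @` M) x.
    have [PA|nPA] := pselect (P A); last by exists point.
    apply: contrapT => nx; apply: noA; exists A; split=> // x Ax.
    by apply: contrapT => nMx; apply: nx; exists x.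
  have Mg0 g A : M g -> P A -> g A <> g0 A.
    by move=> Mg /[dup] PA /g0P[_ nMg0] e; apply: nMg0; exists g.
  apply: (Mmax (M `|` [set g0])).
    split; first exact: subsetUl.
    by move=> /(_ g0 (or_intror erefl)) /Mg0 /(_ PA0).
  split=> [g A [Mg|->] PA|g h A [Mg|->] [Mh|->] PA //].
  - exact: Msec Mg PA.
  - by have [] := g0P _ PA.
  - exact: Minj Mg Mh PA.
  - by move=> /(Mg0 _ _ Mg PA).
  - by move=> /esym /(Mg0 _ _ Mh PA).
exists A; split=> // B PB.
apply: (card_le_trans (subset_card_le AM)).
apply: (card_le_trans (card_image_le _ _)).
have MB : {in M &, injective (fun g : set T -> T => g B)}.
  by move=> g h; rewrite !inE => Mg Mh; exact: Minj Mg Mh PB.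
rewrite -(card_le_eql (inj_card_eq MB)).
by apply: subset_card_le => _ [g Mg <-]; exact: Msec Mg PB.
Qed.

Section spaces.
Variable T : topologicalType.
Implicit Types (A : set T) (U : set (set T)).

Definition nowhere_dense A := (closure A)^° = set0.

Definition meager A :=
  exists N : nat -> set T, (forall n, nowhere_dense (N n)) /\ A = \bigcup_n N n.

Definition open_cover U := U `<=` open /\ \bigcup_(A in U) A = [set: T].

Definition lindelof := forall U, open_cover U ->
  exists V, [/\ V `<=` U, countable V & open_cover V].

Definition star A U := \bigcup_(B in [set B | U B /\ A `&` B !=set0]) B.

Definition S1_star_O_Gamma := forall U : nat -> set (set T),
  (forall n, open_cover (U n)) ->
  exists V : nat -> set T, (forall n, U n (V n)) /\
    forall z, \forall n \near \oo, star (V n) (U n) z.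

Definition star_Rothberger := forall U : nat -> set (set T),
  (forall n, open_cover (U n)) ->
  exists V : nat -> set T, (forall n, U n (V n)) /\
    \bigcup_n star (V n) (U n) = [set: T].

End spaces.
Arguments lindelof : clear implicits.
Arguments S1_star_O_Gamma : clear implicits.
Arguments star_Rothberger : clear implicits.

Definition meager_cover (R : realType) (C : set (set R)) :=
  C `<=` @meager R /\ \bigcup_(A in C) A = [set: R].

Lemma meager_cover_ex (R : realType) : @meager_cover R !=set0.
Proof.
exists [set [set x] | x in [set: R]]; split; last first.
  by apply/seteqP; split=> // x _; exists [set x] => //; exists x.
move=> _ [x _ <-]; exists (fun=> [set x]); split; last first.
  by apply/seteqP; split=> [y yx|y [n _ //]]; exists 0%N.
move=> _; rewrite /nowhere_dense.
rewrite -(closure_id [set x]).1; last first.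
  exact/accessible_closed_set1/hausdorff_accessible/Rhausdorff.
exact: interior_set1.
Qed.

Lemma cov_meager_ex (R : realType) : exists C : set (set R),
  meager_cover C /\ forall C' : set (set R), meager_cover C' -> C #<= C'.
Proof. exact/least_card/meager_cover_ex. Qed.

(* The cardinal cov(M) is represented by a set of that cardinality, namely a
   meager cover of R of least cardinality; only `#<=` comparisons with it are
   meaningful. *)
Definition cov_meager (R : realType) : set (set R) :=
  sval (cid (cov_meager_ex R)).
Arguments cov_meager : clear implicits.

Lemma cov_meagerP (R : realType) : meager_cover (cov_meager R) /\
  forall C : set (set R), meager_cover C -> cov_meager R #<= C.
Proof. by rewrite /cov_meager; case: cid. Qed.

(* Main.v *)
Require Import Defs.
From HB Require Import structures.
From mathcomp Require Import all_boot all_order all_algebra.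
From mathcomp Require Import all_classical all_reals topology normedtype.
From mathcomp Require Import lra.
Set Implicit Arguments.
Unset Strict Implicit.
Unset Printing Implicit Defensive.
Import Order.TTheory GRing.Theory Num.Theory numFieldNormedType.Exports.
Local Open Scope classical_set_scope.

(** Every real x encodes a function n |-> digit n x in such a way that, for
    each f : nat -> nat, the x whose digits eventually disagree with f form a
    meager set; hence fewer than cov(M) functions leave out some x, whose
    digits agree with each of them infinitely often. Since X is Lindelof, the
    given covers may be taken to be countable, say {W n k : k}. Each Y in F then
    has a function f_Y such that every point of Y lies in St(W n (f_Y n)) for
    almost all n, and a g agreeing infinitely often with every f_Y yields the
    required sets W n (g n). *)

Section digits.
Local Open Scope ring_scope.
Variable R : realType.
Implicit Types (a b c d x : R) (f : nat -> nat).

(* The value k is taken where the fractional part of (n + 1) x lies in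
   ]1/(k+2), 1/(k+1)]; where it vanishes, the value is 0. *)
Definition digit (n : nat) x : nat :=
  (Num.truncn (n.+1%:R * x - (Num.floor (n.+1%:R * x))%:~R)^-1).-1.

(** For large [n] the interval from [(n + 1) a] to [(n + 1) b] is longer than 2, so it contains some
    [[p, p + 1]] with [p] an integer, where the fractional part runs through all the intervals that
    define the digits. The choice of [n] precedes that of [k], so that [k] may later be [f n]. *)
Lemma digit_constant (m : nat) a b : a < b -> exists n, (m <= n)%N /\
  forall k, exists c d, [/\ a <= c, c < d, d <= b &
    forall x, c < x < d -> digit n x = k].
Proof.
move=> ab; have ba0 : 0 < b - a by rewrite subr_gt0.
pose n := maxn m (Num.truncn (2 / (b - a))).
exists n; split; first exact: leq_maxl.
set N : R := n.+1%:R => k; have N0 : 0 < N by rewrite ltr0n.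
have Nba : 2 < N * b - N * a.
  rewrite -mulrBr -ltr_pdivrMr //; apply: lt_le_trans (truncnS_gt _) _.
  by rewrite ler_nat ltnS leq_maxr.
pose p := Num.floor (N * a) + 1.
have /andP[pa pa1] := floor_itv (N * a).
have pE : (Num.floor (N * a))%:~R = p%:~R - 1 :> R by rewrite rmorphD /= addrK.
rewrite -/p in pa1; rewrite pE in pa; move: pa pa1 {pE}; set P : R := p%:~R.
clearbody p => pa pa1.
pose i1 : R := k.+1%:R^-1; pose i2 : R := k.+2%:R^-1.
have i1_le1 : i1 <= 1 by rewrite invf_le1 ?ltr0n // ler1n.
have i2_gt0 : 0 < i2 by rewrite invr_gt0 ltr0n.
have i21 : i2 < i1 by rewrite ltf_pV2 ?posrE ?ltr0n // ltr_nat.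
have aP : N * a <= P + i2 by lra.
have Pb : P + i1 <= N * b by lra.
exists ((P + i2) / N), ((P + i1) / N); split.
- by rewrite ler_pdivlMr // mulrC.
- by rewrite ltr_pM2r ?invr_gt0 // ltrD2l.
- by rewrite ler_pdivrMr // mulrC.
move=> x; rewrite ltr_pdivrMr // ltr_pdivlMr // (mulrC x) => /andP[x1 x2].
pose y := N * x - P.
have y1 : y < i1 by rewrite ltrBlDl.
have y2 : i2 < y by rewrite ltrBrDl.
have fx : Num.floor (N * x) = p.
  have Px : P <= N * x by rewrite -subr_ge0 -/y; lra.
  have xP : N * x < P + 1 by rewrite -ltrBlDl -/y; lra.
  by apply: floor_def; rewrite rmorphD; apply/andP; split.
rewrite /digit -/N fx -/P -/y (@truncn_def _ _ k.+1) //.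
have y0 : 0 < y by lra.
rewrite -[X in X <= _]invrK -[X in _ < X]invrK.
by rewrite lef_pV2 ?ltf_pV2 ?posrE ?invr_gt0 ?ltr0n // (ltW y1).
Qed.

Lemma nowhere_dense_digit_neq f (m : nat) :
  nowhere_dense [set x | forall n, (m <= n)%N -> digit n x <> f n].
Proof.
set A := [set x | _]; apply/seteqP; split=> // x.
rewrite /interior => /nbhs_ballP[e /= e0 eA].
have [|n [mn /(_ (f n))[c [d [ac cd db digE]]]]] :=
  @digit_constant m (x - e) (x + e); first by lra.
(* The midpoint of []c, d[] lies in the ball, hence in the closure of [A]; but [A] misses []c, d[],
   where [digit n] equals [f n]. *)
have zI : (c + d) / 2 \in `]c, d[ by rewrite in_itv /=; apply/andP; split; lra.
have /eA clz : ball x e ((c + d) / 2).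
  by rewrite /ball /= ltr_norml; apply/andP; split; lra.
have [y [Ay]] := clz _ (near_in_itvoo zI).
by rewrite /= in_itv /= => /digE; exact: Ay mn.
Qed.

Lemma meager_digit_neq f :
  meager [set x | \forall n \near \oo, digit n x <> f n].
Proof.
exists (fun m => [set x | forall n, (m <= n)%N -> digit n x <> f n]).
split; first exact: nowhere_dense_digit_neq.
apply/seteqP; split=> x /=; first by move=> [m _ xm]; exists m.
by move=> [m _ xm]; exists m.
Qed.

End digits.

Lemma guess_infinitely_often (R : realType) (T : Type) (F : set T)
    (f : T -> nat -> nat) : card_lt F (cov_meager R) ->
  exists g : nat -> nat, forall t, F t ->
    ~ \forall n \near \oo, g n <> f t n.
Proof.
case/andP=> _ /negP ncov; have [_ covP] := cov_meagerP R.
pose A t := [set x : R | \forall n \near \oo, digit n x <> f t n].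
have [x nAx] : exists x, forall t, F t -> ~ A t x.
  (* Otherwise the sets [A t] with [t] in [F] would form a meager cover of cardinality at most that
     of [F]. *)
  apply: contrapT => nx; apply: ncov.
  apply: card_le_trans (card_image_le A F).
  apply: covP; split=> [_ [t _ <-]|]; first exact: meager_digit_neq.
  apply/seteqP; split=> // x _; apply: contrapT => nAx.
  by apply: nx; exists x => t Ft Ax; apply: nAx; exists (A t) => //; exists t.
by exists (fun n => digit n x).
Qed.

Section covers.
Variable X : topologicalType.
Implicit Types (U : set (set X)) (Y V : set X).

Lemma open_cover_range U : [set: X] !=set0 -> lindelof X -> open_cover U ->
  exists W : nat -> set X, range W `<=` U /\ open_cover (range W).
Proof.
move=> [x _] lindX /lindX[V [VU /pfcard_geP[V0|/surjfunPex[W VW]] oV]].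
  (* An empty subcover could not be enumerated, but it would miss [x]. *)
  by have := oV.2; rewrite V0 bigcup_set0 => /seteqP[_ /(_ x I)].
by exists W; rewrite -VW.
Qed.

Lemma open_cover_subspace U Y : open_cover U ->
  open_cover [set (set_val @^-1` B : set (set_type Y)) | B in U].
Proof.
move=> [oU cU]; split=> [_ [B UB <-]|].
  by exists B => //; exact: oU.
apply/seteqP; split=> // y _.
have : [set: X] (set_val y) by [].
by rewrite -cU => -[B UB By]; exists (set_val @^-1` B) => //; exists B.
Qed.

Lemma star_mono (A : set X) U U' : U `<=` U' -> star A U `<=` star A U'.
Proof. by move=> UU' x [B [UB AB] Bx]; exists B => //; split=> //; exact: UU'. Qed.

(** The property of [Y] is applied to the traces of the covers on [Y]. Each selected trace is lifted
    to a member of the cover; traces that meet in [Y] come from sets that meet in [X], so stars only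
    grow. *)
Lemma S1_star_subspace (U : nat -> set (set X)) Y :
  (forall n, open_cover (U n)) -> S1_star_O_Gamma (set_type Y) ->
  exists V : nat -> set X, (forall n, U n (V n)) /\
    forall y, Y y -> \forall n \near \oo, star (V n) (U n) y.
Proof.
move=> oU /(_ _ (fun n => open_cover_subspace Y (oU n)))[V' [UV' V'star]].
have /choice[V VP] n : exists B, U n B /\ set_val @^-1` B = V' n.
  by have [B UB BE] := UV' n; exists B.
exists V; split=> [n|y Yy]; first by have [] := VP n.
apply: filterS (V'star (exist _ y (mem_set Yy))) => n.
move=> [_ [[B UB <-] [z [V'z Bz]]] By]; exists B => //; split=> //.
by exists (set_val z); split=> //; have [_ VE] := VP n; move: V'z; rewrite -VE.
Qed.

End covers.

Theorem theorem4p11 (R : realType) (X : topologicalType)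
  (X0 : [set: X] !=set0) (lindX : lindelof X)
  (F : set (set X)) (cardF : card_lt F (cov_meager R))
  (coverF : \bigcup_(Y in F) Y = [set: X])
  (F0 : forall Y : set X, F Y -> Y !=set0)
  (S1F : forall Y : set X, F Y -> S1_star_O_Gamma (set_type Y)) :
  star_Rothberger X.
Proof.
move=> U oU.
have /choice[W WP] n := open_cover_range X0 lindX (oU n).
have /choice[f fP] Y : exists f : nat -> nat, F Y ->
    forall y, Y y -> \forall n \near \oo, star (W n (f n)) (range (W n)) y.
  have [FY|nFY] := pselect (F Y); last by exists id.
  have [V [WV Vstar]] := S1_star_subspace (fun n => (WP n).2) (S1F _ FY).
  have /choice[f fE] n : exists k, W n k = V n.
    by have [k _ kE] := WV n; exists k.
  by exists f => _ y /Vstar; apply: filterS => n; rewrite fE.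
have [g gP] := guess_infinitely_often f cardF.
exists (fun n => W n (g n)); split=> [n|]; first by apply: (WP n).1; exists (g n).
apply/seteqP; split=> // x _.
have : [set: X] x by [].
(* If no chosen star contained [x], then [g n] would differ from [f Y n] whenever [x] lies in the
   star of [W n (f Y n)], that is, for almost all [n]. *)
rewrite -coverF => -[Y FY Yx]; apply: contrapT => nx; apply: (gP _ FY).
apply: filterS (fP _ FY _ Yx) => n xstar gE; apply: nx; exists n => //.
by rewrite gE; exact: star_mono (WP n).1 _ xstar.
Qed.
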